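(* Let $m,\lambda\in\mathbb N_0$, $\varepsilon_{2m+1}\in\{-1,1\}$, and let $\psi_{2m+1}\in\mathcal N_\lambda$ satisfy $\psi_{2m+1}(iy)=o(y)$ as $y\to+\infty$. Let $\beta_0,\dots,\beta_m$ be real and $\alpha_0,\dots,\alpha_{2m}$ be real and nonzero, and let $$\psi(z)=-\cfrac{\alpha_0}{z-\beta_0-\cfrac{\alpha_1\alpha_2}{z-\beta_1-\cdots-\cfrac{\alpha_{2m-1}\alpha_{2m}}{z-\beta_m+\varepsilon_{2m+1}\psi_{2m+1}(z)}}},$$ that is, $\psi=-\alpha_0/D_0$ where $D_m(z)=z-\beta_m+\varepsilon_{2m+1}\psi_{2m+1}(z)$ and $D_{j-1}(z)=z-\beta_{j-1}-\alpha_{2j-1}\alpha_{2j}/D_j(z)$ for $j=m,\dots,1$. Put $$\varepsilon_j=\varepsilon_{2m+1}\operatorname{sign}\prod_{k=j}^{2m}\alpha_k\quad (j=0,1,\dots,2m),$$ and let $\kappa$ be the number of negative entries in the sequence $\varepsilon_1,\varepsilon_3,\dots,\varepsilon_{2m+1}$, that is, $\kappa=\frac{m+1}2-\sum_{j=0}^m\frac{\varepsilon_{2j+1}}2$. Then $\varepsilon_0\psi\in\mathcal N_{\kappa+\lambda}$. The particular choice $\psi_{2m+1}(z)\equiv0$ and $\varepsilon_{2m+1}=1$ yields $\varepsilon_0\psi\in\mathcal N_\kappa$ and $-\varepsilon_0\psi\in\mathcal N_{m+1-\kappa}=\mathcal N_{\deg\psi-\kappa}$ for $\kappa=\frac m2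-\sum_{j=1}^m\frac{\varepsilon_{2j-1}}2$.
   Context: $\mathbb N_0=\{0,1,2,\dots\}$, $\mathbb N=\{1,2,\dots\}$, $\mathbb C_+=\{z:\operatorname{Im}z>0\}$. For points $z_1,\dots,z_n\in\mathbb C_+$ that are not poles of $f$, the Pick matrix is $H_f(z_1,\dots,z_n)=\left[\frac{f(z_k)-\overline{f(z_j)}}{z_k-\overline{z_j}}\right]_{k,j=1}^n$. For $\kappa\in\mathbb N_0$, $f\in\mathcal N_\kappa$ means that $f$ is meromorphic in $\mathbb C_+$ (and extended to the lower half-plane by the symmetry $f(\overline z)=\overline{f(z)}$), that $H_f(z_1,\dots,z_n)$ has at most $\kappa$ negative eigenvalues for every $n\in\mathbb N$ and every choice of points, and exactly $\kappa$ for some choice. The degree $\deg\psi$ of a rational function is the maximum of the degrees of its numerator and denominator in lowest terms. *)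

(* Defs.v *)
From HB Require Import structures.
From mathcomp Require Import all_boot all_order all_algebra.
From mathcomp Require Import all_classical all_reals all_analysis.
From mathcomp Require Import complex.
Set Implicit Arguments.
Unset Strict Implicit.
Unset Printing Implicit Defensive.
Import Order.TTheory GRing.Theory Num.Theory numFieldNormedType.Exports.
Local Open Scope ring_scope.
Local Open Scope complex_scope.

(* The Riemann sphere: [None] is the point at infinity.  A meromorphic function
   takes the value [None] exactly at its poles, so that the sphere-valued
   operations below compute sums, reciprocals and continued fractions of
   meromorphic functions pointwise, with no exceptional points. *)
Definition sphere (R : realType) : Type := option R[i].

(* The finite value; the value 0 at infinity is never used. *)
Definition finval (R : realType) (w : sphere R) : R[i] := odflt 0 w.

Definition sinv (R : realType) (w : sphere R) : sphere R :=
  if w is Some x then (if x == 0 then None else Some x^-1) else Some 0.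

Definition sadd (R : realType) (a : R[i]) (w : sphere R) : sphere R :=
  omap (fun x => a + x) w.

(* To be used with c != 0 only. *)
Definition sscale (R : realType) (c : R) (w : sphere R) : sphere R :=
  omap (fun x => c%:C * x) w.

(* Complex differentiability: [derivable] is over the scalar field R[i]. *)
Definition holomorphic_at (R : realType) (f : R[i] -> sphere R) (z0 : R[i]) :
    Prop :=
  \forall z \near (z0 : R[i]^o),
    f z <> None /\
    derivable ((fun x => finval (f x)) : R[i]^o -> R[i]^o) (z : R[i]^o) 1.

(* Near every point of the open upper half-plane, f is holomorphic, or 1/f is
   holomorphic and f has no pole except possibly at the point itself. *)
Definition meromorphic_upper (R : realType) (f : R[i] -> sphere R) : Prop :=
  forall z0 : R[i], 0 < complex.Im z0 ->
    holomorphic_at f z0 \/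
    (holomorphic_at (fun z => sinv (f z)) z0 /\
     (\forall z \near (z0 : R[i]^o)^'%classic, f z <> None)).

Definition pick_matrix (R : realType) (f : R[i] -> sphere R) (n : nat)
    (z : 'I_n -> R[i]) : 'M[R[i]]_n :=
  \matrix_(k < n, j < n)
    ((finval (f (z k)) - Num.conj (finval (f (z j)))) /
     (z k - Num.conj (z j))).

Definition admissible_points (R : realType) (f : R[i] -> sphere R) (n : nat)
    (z : 'I_n -> R[i]) : Prop :=
  forall k : 'I_n, 0 < complex.Im (z k) /\ f (z k) <> None.

(* The roots of the characteristic polynomial, with multiplicity. *)
Definition eigenvalues (R : realType) (n : nat) (A : 'M[R[i]]_n) : seq R[i] :=
  sval (closed_field_poly_normal (char_poly A)).

(* In the partial order of R[i], [x < 0] means that x is real and negative. *)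
Definition num_neg_eigenvalues (R : realType) (n : nat) (A : 'M[R[i]]_n) : nat :=
  count (fun x => x < 0) (eigenvalues A).

(* The generalized Nevanlinna class.  Values on the real line are irrelevant. *)
Definition nevanlinna (R : realType) (kappa : nat) (f : R[i] -> sphere R) :
    Prop :=
  [/\ meromorphic_upper f,
      (forall z : R[i], 0 < complex.Im z ->
         f (Num.conj z) = omap Num.conj (f z)),
      (forall (n : nat) (z : 'I_n -> R[i]), (0 < n)%N ->
         admissible_points f z ->
         (num_neg_eigenvalues (pick_matrix f z) <= kappa)%N)
    & exists (n : nat) (z : 'I_n -> R[i]),
        [/\ (0 < n)%N, admissible_points f z
          & num_neg_eigenvalues (pick_matrix f z) = kappa] ].

(* f(iy) = o(y) as y -> +oo; in particular iy is not a pole for large y. *)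
Definition littleo_imag_axis (R : realType) (f : R[i] -> sphere R) : Prop :=
  forall e : R, 0 < e -> \forall y \near +oo,
    exists2 w : R[i], f (0 +i* y) = Some w & `|w| <= (e * y)%:C.

Section ContinuedFraction.
Variables (R : realType) (alpha beta : nat -> R) (eps : R).
Variable psi : R[i] -> sphere R.

(* [cf_denom k j] is the denominator D_j when k = m - j levels lie below it. *)
Fixpoint cf_denom (k j : nat) (z : R[i]) : sphere R :=
  match k with
  | 0%N => sadd (z - (beta j)%:C) (sscale eps (psi z))
  | k'.+1 =>
      sadd (z - (beta j)%:C)
        (sscale (- (alpha j.*2.+1 * alpha j.*2.+2))
           (sinv (cf_denom k' j.+1 z)))
  end.

Definition cfrac (m : nat) (z : R[i]) : sphere R :=
  sscale (- alpha 0) (sinv (cf_denom m 0 z)).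
End ContinuedFraction.

(* eps_j for 0 <= j <= 2m+1, where eps = eps_(2m+1). *)
Definition cf_sign (R : realType) (alpha : nat -> R) (eps : R) (m j : nat) : R :=
  eps * Num.sg (\prod_(j <= k < m.*2.+1) alpha k).

Definition cf_kappa (R : realType) (alpha : nat -> R) (eps : R) (m : nat) : nat :=
  #|[set j : 'I_m.+1 | cf_sign alpha eps m j.*2.+1 < 0]|.

(* f = p/q in lowest terms and d = max(deg p, deg q). *)
Definition rational_of_degree (R : realType) (f : R[i] -> sphere R) (d : nat) :
    Prop :=
  exists p q : {poly R[i]},
    [/\ q != 0, coprimep p q,
        (forall z : R[i],
           f z = if q.[z] == 0 then None else Some (p.[z] / q.[z]))
      & d = maxn (size p).-1 (size q).-1].

(* Main.v *)
Require Import Defs.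
From HB Require Import structures.
From mathcomp Require Import all_boot all_order all_algebra.
From mathcomp Require Import all_classical all_reals all_analysis.
From mathcomp Require Import complex ring zify lra.
Set Implicit Arguments.
Unset Strict Implicit.
Unset Printing Implicit Defensive.
Import Order.TTheory GRing.Theory Num.Theory numFieldNormedType.Exports.
Local Open Scope ring_scope.
Local Open Scope complex_scope.

(** The signs [eps_j] are chosen so that, after multiplying the denominator
    [D_j] by [eps_(2j+1)], the continued fraction is built from the last function
    by two kinds of steps: adding [d (z - b)] with [d = eps_(2j+1) = 1] or [-1],
    and [g |-> - c / g] with [c > 0].  Every function to which a linear term is
    added is o(y) on the imaginary axis, and every function that is inverted
    grows linearly there.  It suffices to see what each step does to the number
    of negative squares; [kappa] counts the slopes [d = -1].

    Adding [d (z - b)] adds the matrix [d 1 1^*] of rank one to every Pick matrix,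
    so the index grows by at most one if [d = -1], and not at all if [d = 1].
    That the new index is attained uses one additional point [i y] with large
    [y]: as the function is o(y), the Pick matrix tends to the direct sum of the
    old Pick matrix with zero, plus [d 1 1^*]; this is congruent to the direct sum
    of the old matrix with [d], and the number of negative eigenvalues is
    lower semicontinuous ([nevanlinna_affine]).

    The Pick matrices of [- c / g] and [g] at common points are congruent by a
    diagonal matrix, which gives equality of the indices ([nevanlinna_sinv]) as
    soon as zeros and poles of [g] can be avoided by moving the points a little
    ([shift_points]).  For this the zeros must be isolated.  Instead of the
    identity theorem, an algebraic fact is used ([few_zeros]): if [g] has [N]
    zeros in the upper half-plane and [N] points where it is finite and
    nonzero, the Pick matrix at all of them has a vanishing diagonal block and
    an invertible Cauchy block beside it, hence at least [N] negative
    eigenvalues.  As [g] grows linearly on the imaginary axis, there are infinitely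
    many points of the second kind, so [g] has finitely many zeros.

    In the rational case the last function is zero, so it can be given either
    sign without changing [psi]; the sign -1 changes all the [eps_j] and yields the
    statement on [- eps_0 psi]. *)

(** * Negative definite subspaces of hermitian forms *)

(** Clearing denominators turns the linear relation into a polynomial of degree
    less than [n] that vanishes at the [n] points [t j]; its values at the
    points [s i] then give back the coefficients.  So Cauchy matrices are
    invertible. *)
Lemma cauchy_kernel_free (F : fieldType) n (s t v : 'I_n -> F) :
  injective s -> injective t -> (forall i j, t j - s i != 0) ->
  (forall j, \sum_i v i / (t j - s i) = 0) -> forall i, v i = 0.
Proof.
move=> sI tI st v0 i0.
pose p : {poly F} := \sum_i v i *: \prod_(l | l != i) ('X - (s l)%:P).
have pE x i : (\prod_(l | l != i) ('X - (s l)%:P)).[x] = \prod_(l | l != i) (x - s l).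
  by rewrite horner_prod; apply: eq_bigr => l _; rewrite hornerXsubC.
have p0 : p = 0.
  apply/eqP/negPn/negP => pn0.
  have sp : (size p <= n)%N.
    apply: (leq_trans (size_sum _ _ _)); apply/bigmax_leqP => i _.
    apply: leq_trans (size_scale_leq _ _) _.
    rewrite -big_filter size_prod_XsubC size_filter.
    by rewrite -sum1_count sum1_card cardC1 card_ord; have := ltn_ord i; lia.
  have := @max_poly_roots _ p [seq t j | j <- enum 'I_n] pn0.
  rewrite size_map size_enum_ord ltnNge sp map_inj_uniq// enum_uniq.
  suff -> : all (root p) [seq t j | j <- enum 'I_n] by move=> /(_ isT isT).
  apply/allP => _ /mapP[j _ ->]; rewrite /root horner_sum.
  rewrite (eq_bigr (fun i => \prod_l (t j - s l) * (v i / (t j - s i)))).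
    by rewrite -mulr_sumr v0 mulr0.
  move=> i _; rewrite hornerZ pE [X in _ = X * _](bigD1 i)//=.
  by field; exact: st.
have := congr1 (fun q : {poly F} => q.[s i0]) p0.
rewrite horner0 horner_sum (bigD1 i0)//= [X in _ + X]big1 => [|i ii0]; last first.
  rewrite hornerZ pE (bigD1 i0) 1?eq_sym//= subrr.
  by rewrite mul0r mulr0.
rewrite addr0 hornerZ pE => /eqP; rewrite mulf_eq0 => /orP[/eqP//|].
rewrite prodf_seq_eq0 => /hasP[l _ /andP[li]].
by rewrite subr_eq0 => /eqP/sI e; rewrite e eqxx in li.
Qed.

Section NegativeIndex.
Local Open Scope sesquilinear_scope.
Variable C : numClosedFieldType.

Definition qform n (A : 'M[C]_n) (u : 'rV[C]_n) : C := (u *m A *m u ^t*) 0 0.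

(** Inertia without eigenvalues: all the perturbation arguments move a negative
    definite subspace from one matrix to another. *)
Definition negative_on n (A : 'M[C]_n) (r : nat) : Prop :=
  exists2 W : 'M[C]_n, (r <= \rank W)%N &
    forall u : 'rV[C]_n, (u <= W)%MS -> u != 0 -> qform A u < 0.

Lemma qformE n (A : 'M[C]_n) u :
  qform A u = \sum_i \sum_j u 0 i * A i j * (u 0 j)^*.
Proof.
rewrite /qform mxE exchange_big /=; apply: eq_bigr => j _.
by rewrite !mxE mulr_suml.
Qed.

Lemma qform1E n (u : 'rV[C]_n) : qform 1%:M u = \sum_i `|u 0 i| ^+ 2.
Proof. by rewrite /qform mulmx1 mxE; apply: eq_bigr => i _; rewrite !mxE normCK. Qed.

Lemma qform_diag n (d u : 'rV[C]_n) :
  qform (diag_mx d) u = \sum_i d 0 i * `|u 0 i| ^+ 2.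
Proof.
rewrite /qform mul_mx_diag mxE; apply: eq_bigr => i _.
by rewrite !mxE normCK; ring.
Qed.

Lemma qform_congr n p (A : 'M[C]_n) (M : 'M[C]_(p, n)) (u : 'rV[C]_p) :
  qform (M *m A *m M ^t*) u = qform A (u *m M).
Proof. by rewrite /qform trmx_mul map_mxM !mulmxA. Qed.

Lemma qform1_gt0 n (u : 'rV[C]_n) : u != 0 -> 0 < qform 1%:M u.
Proof.
move=> u0; rewrite qform1E lt_def sumr_ge0 ?andbT => [|i _]; last first.
  by rewrite exprn_ge0.
apply: contra u0 => /eqP s0; apply/eqP/rowP => i; rewrite mxE.
have /eqP := s0; rewrite psumr_eq0 => [/allP/(_ i)|j _]; last by rewrite exprn_ge0.
by rewrite mem_index_enum => /(_ isT)/=; rewrite expf_eq0 normr_eq0 /= => /eqP.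
Qed.

(** A coordinate subspace, encoded as the row space of the projection onto it. *)
Definition coord_mx n (P : pred 'I_n) : 'M[C]_n := diag_mx (\row_i (P i)%:R).

Lemma rank_coord_mx n (P : pred 'I_n) : (#|P| <= \rank (coord_mx P))%N.
Proof.
have := @mxdirect_delta C 'I_n P n id (fun i j _ _ => id).
rewrite mxdirectE /= => /eqP e.
have <- : (\sum_(i | P i) \rank <<delta_mx 0%R i : 'rV[C]_n>>%MS)%N = #|P|.
  rewrite (eq_bigr (fun=> 1%N)) ?sum1_card// => i _.
  by rewrite mxrank_gen mxrank_delta.
rewrite -e mxrankS//; apply/sumsmx_subP => i Pi; rewrite genmxE.
suff -> : delta_mx 0 i = row i (coord_mx P) by exact: row_sub.
apply/rowP => j; rewrite !mxE eqxx /= eq_sym.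
by rewrite Pi; case: (i == j).
Qed.

Lemma sub_coord_mx n (P : pred 'I_n) (u : 'rV[C]_n) i :
  (u <= coord_mx P)%MS -> ~~ P i -> u 0 i = 0.
Proof.
by move=> /submxP[w ->] /negPf Pi; rewrite mul_mx_diag !mxE Pi mulr0.
Qed.

Section Hermitian.
Variables (n : nat) (A : 'M[C]_n).
Hypothesis hA : A ^t* = A.
Let P := spectralmx A.
Let d := spectral_diag A.

Let A_eq : A = P ^t* *m diag_mx d *m P.
Proof.
have hA' : A \is hermsymmx by apply/is_hermitianmxP; rewrite expr0 scale1r hA.
rewrite -(invmx_unitary (spectral_unitarymx A)).
exact/orthomx_spectralP/hermitian_normalmx.
Qed.

Let d_real i : d 0 i \is Num.real.
Proof.
have hA' : A \is hermsymmx by apply/is_hermitianmxP; rewrite expr0 scale1r hA.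
by have /mxOverP/(_ 0 i) := hermitian_spectral_diag_real hA'.
Qed.

Let PP : P *m P ^t* = 1%:M. Proof. exact/unitarymxP/spectral_unitarymx. Qed.
Let PP' : P ^t* *m P = 1%:M. Proof. exact: mulmx1C. Qed.

Let Punit : P \in unitmx. Proof. exact: spectral_unit. Qed.

Let qA v : qform A (v *m P) = \sum_i d 0 i * `|v 0 i| ^+ 2.
Proof.
rewrite -qform_diag {1}A_eq -qform_congr; congr qform.
by rewrite !mulmxA PP mul1mx -mulmxA PP mulmx1.
Qed.

Let q1 v : qform 1%:M (v *m P) = \sum_i `|v 0 i| ^+ 2.
Proof. by rewrite -qform1E -qform_congr mulmx1 PP. Qed.

Lemma char_poly_spectral : char_poly A = \prod_i ('X - (d 0 i)%:P).
Proof.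
rewrite -[RHS]/(\prod_(i < n) _).
have -> : \prod_(i < n) ('X - (d 0 i)%:P) = char_poly (diag_mx d).
  rewrite char_poly_trig ?diag_mx_is_trig//.
  by apply: eq_bigr => i _; rewrite !mxE eqxx mulr1n.
rewrite /char_poly.
have -> : char_poly_mx A =
    map_mx polyC (P ^t*) *m char_poly_mx (diag_mx d) *m map_mx polyC P.
  rewrite /char_poly_mx mulmxBr mulmxBl -!map_mxM -A_eq; congr (_ - _).
  by rewrite mul_mx_scalar -scalemxAl -map_mxM PP' map_mx1 scalemx1.
rewrite !det_mulmx mulrAC -det_mulmx -map_mxM PP' map_mx1 det1.
by rewrite mul1r.
Qed.

Lemma count_spectral s : char_poly A = \prod_(x <- s) ('X - x%:P) ->
  count (fun x => x < 0) s = #|[pred i | d 0 i < 0]|.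
Proof.
rewrite char_poly_spectral => e.
have /permP <- : perm_eq [seq d 0 i | i <- index_enum 'I_n] s.
  by apply: prod_XsubC_eq; rewrite big_map.
by rewrite count_map cardE /enum_mem size_filter.
Qed.

(** A negative definite subspace meets the span of the eigenvectors with
    nonnegative eigenvalue trivially, so the dimensions add up to at most [n]. *)
Lemma negative_on_le r s : char_poly A = \prod_(x <- s) ('X - x%:P) ->
  negative_on A r -> (r <= count (fun x => (x < 0)%R) s)%N.
Proof.
move=> /count_spectral -> [W rW Wneg].
pose N := coord_mx [pred i | ~~ (d 0 i < 0)] *m P.
have rN : (n <= #|[pred i | (d 0 i < 0)%R]| + \rank N)%N.
  rewrite mxrankMfree ?row_free_unit// -[leqLHS]card_ord.
  by rewrite -(cardC [pred i | (d 0 i < 0)%R]) leq_add2l; apply: rank_coord_mx.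
suff WN : (W :&: N)%MS = 0.
  have := rank_leq_col (W + N)%MS; rewrite mxrank_disjoint_sum// => le_n.
  rewrite (leq_trans rW)// -(leq_add2r (\rank N)).
  exact: leq_trans rN.
apply/eqP/rowV0P => u; rewrite sub_capmx => /andP[uW /submxP[w]].
rewrite mulmxA => ue; apply/eqP/negP => /negP u0.
have := Wneg u uW u0; rewrite ue qA; apply/negP; rewrite -real_leNgt ?rpred0//.
  apply: sumr_ge0 => i _; set v := w *m _.
  have [di|di] := boolP (d 0 i < 0).
    rewrite (@sub_coord_mx _ _ v i (submxMl _ _)) /= ?di//.
    by rewrite normr0 expr0n mulr0.
  by rewrite mulr_ge0 ?exprn_ge0// real_leNgt ?rpred0.
by apply: rpred_sum => i _; rewrite realM// realX// normr_real.
Qed.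

(** On the span of the negative eigenvectors the form is bounded by its largest
    negative eigenvalue, uniformly; this gap is what makes the subspace stable
    under perturbation. *)
Lemma negative_onW s : char_poly A = \prod_(x <- s) ('X - x%:P) ->
  exists (W : 'M[C]_n) (e : C), [/\ 0 < e,
    (count (fun x => (x < 0)%R) s <= \rank W)%N &
    forall u : 'rV[C]_n, (u <= W)%MS -> qform A u <= - e * qform 1%:M u].
Proof.
move=> /count_spectral ->.
(* Each [(- d 0 i)^-1] is a term of [S], so [S^-1] bounds all [- d 0 i] below. *)
pose S := \sum_(i | d 0 i < 0) (- d 0 i)^-1 + 1.
have S0 : 0 < S.
  rewrite ltr_wpDl// sumr_ge0// => i di.
  by rewrite invr_ge0 oppr_ge0 ltW.
exists (coord_mx [pred i | d 0 i < 0] *m P), S^-1; split.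
- by rewrite invr_gt0.
- by rewrite mxrankMfree ?row_free_unit// rank_coord_mx.
move=> u /submxP[w]; rewrite mulmxA => ->; rewrite qA q1 mulr_sumr.
apply: ler_sum => i _; set v := w *m _.
have [di|di] := boolP (d 0 i < 0); last first.
  by rewrite (@sub_coord_mx _ _ v i (submxMl _ _))//= normr0 expr0n !mulr0.
apply: ler_wpM2r; first by rewrite exprn_ge0.
rewrite -[leLHS]opprK lerN2 -[leRHS]invrK lef_pV2 ?posrE ?invr_gt0 ?oppr_gt0//.
rewrite /S (bigD1 i)//= -addrA lerDl addr_ge0// sumr_ge0// => j /andP[dj _].
by rewrite invr_ge0 oppr_ge0 ltW.
Qed.

End Hermitian.

Lemma qformD n (A B : 'M[C]_n) u : qform (A + B) u = qform A u + qform B u.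
Proof. by rewrite /qform mulmxDr mulmxDl mxE. Qed.

Lemma qformZ n a (A : 'M[C]_n) u : qform (a *: A) u = a * qform A u.
Proof. by rewrite /qform -scalemxAr -scalemxAl mxE. Qed.

Lemma qform_const1 n (u : 'rV[C]_n) : qform (const_mx 1) u = `|\sum_i u 0 i| ^+ 2.
Proof.
rewrite qformE normCK raddf_sum mulr_suml; apply: eq_bigr => i _.
by rewrite mulr_sumr; apply: eq_bigr => j _; rewrite mxE mulr1.
Qed.

Lemma qform_real n (A : 'M[C]_n) u : A ^t* = A -> qform A u \is Num.real.
Proof.
move=> hA; apply/CrealP; rewrite !qformE !rmorph_sum exchange_big /=.
apply: eq_bigr => i _; rewrite !rmorph_sum; apply: eq_bigr => j _.
rewrite -[in RHS]hA !mxE !rmorphM/= !conjCK; ring.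
Qed.

Lemma negative_onI n (A : 'M[C]_n) r p (W : 'M[C]_(p, n)) : (r <= \rank W)%N ->
  (forall u : 'rV[C]_n, (u <= W)%MS -> u != 0 -> qform A u < 0) ->
  negative_on A r.
Proof.
by move=> rW neg; exists <<W>>%MS => [|u]; rewrite ?mxrank_gen ?genmxE; last exact: neg.
Qed.

Lemma negative_on_congr n p (A : 'M[C]_n) (M : 'M[C]_(p, n)) r : row_free M ->
  negative_on (M *m A *m M ^t*) r -> negative_on A r.
Proof.
move=> Mfree [W rW neg]; apply: (@negative_onI _ _ _ _ (W *m M)).
  by rewrite mxrankMfree.
move=> u /submxP[w]; rewrite mulmxA => -> u0; rewrite -qform_congr.
by apply: neg; [exact: submxMl|apply: contraNneq u0 => ->; rewrite mul0mx].
Qed.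

Lemma negative_on_subconst n (A : 'M[C]_n) r :
  negative_on (A + const_mx 1) r -> negative_on A r.
Proof.
move=> [W rW neg]; exists W => // u uW u0.
apply: le_lt_trans (neg u uW u0).
by rewrite qformD qform_const1 lerDl exprn_ge0.
Qed.

(** The two forms agree on the hyperplane of vectors with coordinate sum zero. *)
Lemma negative_on_addconst n (A : 'M[C]_n) r :
  negative_on (A - const_mx 1) r -> negative_on A r.-1.
Proof.
move=> [W rW neg]; pose e : 'cV[C]_n := const_mx 1.
exists (W :&: kermx e)%MS => [|u].
  have := mxrank_sum_cap W (kermx e).
  have := rank_leq_col (W + kermx e)%MS.
  have := rank_leq_col e; rewrite mxrank_ker.
  have := rank_leq_row e.
  by lia.
rewrite sub_capmx => /andP[uW /sub_kermxP ue] u0.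
have := neg u uW u0; rewrite qformD -scaleN1r qformZ qform_const1.
suff -> : \sum_i u 0 i = 0 by rewrite normr0 expr0n mulr0 addr0.
have := congr1 (fun M : 'M[C]_1 => M 0 0) ue; rewrite !mxE => ue0; rewrite -[RHS]ue0.
by apply: eq_bigr => i _; rewrite mxE mulr1.
Qed.

(** A limit of Pick matrices, when one further point [i y] escapes to infinity:
    the entries involving it tend to zero if the function is o(y). *)
Definition pad_mx n (A : 'M[C]_n) : 'M[C]_(n + 1) := block_mx A 0 0 0.

Lemma qform_pad n (A : 'M[C]_n) u : qform (pad_mx A) u = qform A (lsubmx u).
Proof.
rewrite /qform -{1 2}[u]hsubmxK mul_row_block !mulmx0 !addr0 tr_row_mx map_col_mx.
by rewrite mul_row_col mul0mx addr0.
Qed.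

(** The new coordinate can cancel the coordinate sum, which makes the rank one
    perturbation invisible. *)
Lemma negative_on_pad_add n (A : 'M[C]_n) r :
  negative_on A r -> negative_on (pad_mx A + const_mx 1) r.
Proof.
move=> [W rW neg]; pose M : 'M[C]_(n, n + 1) := row_mx 1%:M (const_mx (-1)).
have Mfree : row_free M.
  apply/row_freeP; exists (col_mx 1%:M 0).
  by rewrite mul_row_col mulmx0 addr0 mulmx1.
apply: (@negative_onI _ _ _ _ (W *m M)); first by rewrite mxrankMfree.
move=> u /submxP[w]; rewrite mulmxA => ->; set v := w *m W => u0.
rewrite qformD qform_pad qform_const1 big_split_ord /= big_ord1.
rewrite mul_mx_row mulmx1 row_mxKl row_mxEr.
under eq_bigr do rewrite row_mxEl.
have -> : (v *m const_mx (-1) : 'rV_1) 0 0 = - \sum_i v 0 i.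
  rewrite mxE -sumrN; apply: eq_bigr => i _; by rewrite [const_mx _ _ _]mxE mulrN1.
rewrite subrr normr0 expr0n addr0; apply: neg; first exact: submxMl.
by apply: contraNneq u0 => ->; rewrite mul0mx.
Qed.

(** The new coordinate vector, on which the form takes the value -1, is
    added to the subspace. *)
Lemma negative_on_pad_sub n (A : 'M[C]_n) r :
  negative_on A r -> negative_on (pad_mx A - const_mx 1) r.+1.
Proof.
move=> [W rW neg].
apply: (@negative_onI _ _ _ _ (block_mx W 0 0 1%:M : 'M[C]_(n + 1))).
  by rewrite rank_diag_block_mx mxrank1 addn1.
move=> u /submxP[w].
rewrite -[w]hsubmxK mul_row_block !mulmx0 addr0 add0r mulmx1.
set v := _ *m W; set t := rsubmx w => -> u0.
rewrite qformD qform_pad -scaleN1r qformZ mulN1r row_mxKl qform_const1.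
have [v0|v0] := eqVneq v 0; last first.
  apply: le_lt_trans (neg v (submxMl _ _) v0).
  by rewrite gerDl oppr_le0 exprn_ge0.
rewrite v0 in u0 *; rewrite /qform !mul0mx mxE add0r oppr_lt0.
rewrite exprn_gt0// normr_gt0 big_split_ord /= big1 ?add0r => [|i _].
  rewrite big_ord1 row_mxEr; apply: contraNneq u0 => t0.
  by apply/eqP; rewrite -[RHS]row_mx0; congr row_mx; apply/rowP => i; rewrite ord1 t0 mxE.
by rewrite row_mxEl mxE.
Qed.

(** A form with an [n]-dimensional isotropic subspace, nondegenerately paired
    with a complement, has signature [(n, n)]. *)
Lemma negative_on_hyperbolic n (A B : 'M[C]_n) : A ^t* = A -> B \in unitmx ->
  negative_on (block_mx 0 B (B ^t*) A) n.
Proof.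
move=> hA Bu; set H := block_mx _ _ _ _.
(* Chosen so that the rows of [row_mx X 1] have Gram matrix [-2]. *)
pose X := - (2^-1 *: A + 1%:M) *m invmx B.
pose M : 'M[C]_(n, n + n) := row_mx X 1%:M.
have Mfree : row_free M.
  apply/row_freeP; exists (col_mx 0 1%:M).
  by rewrite mul_row_col mulmx0 add0r mulmx1.
have XB : X *m B = - (2^-1 *: A + 1%:M) by rewrite mulmxKV.
apply: (negative_on_congr Mfree).
have -> : M *m H *m M ^t* = (-2) *: 1%:M.
  rewrite mul_row_block mulmx0 add0r !mul1mx tr_row_mx map_col_mx mul_row_col.
  rewrite trmx1 map_mx1 mulmx1.
  have -> : B ^t* *m X ^t* = X *m B.
    rewrite -map_mxM -trmx_mul XB; apply/matrixP => i j.
    rewrite !mxE rmorphN rmorphD rmorphM /= fmorphV !rmorph_nat eq_sym.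
    by rewrite -[in RHS]hA !mxE.
  rewrite XB; apply/matrixP => i j; rewrite !mxE.
  by field.
exists 1%:M => [|u _ u0]; first by rewrite mxrank1.
by rewrite qformZ mulNr oppr_lt0 mulr_gt0// qform1_gt0.
Qed.

(** Lower semicontinuity of the index: a small change of the entries does not
    close the gap [e] of the previous estimate. *)
Lemma negative_on_robust n (A : 'M[C]_n) s : A ^t* = A ->
  char_poly A = \prod_(x <- s) ('X - x%:P) ->
  exists2 eta : C, 0 < eta & forall B : 'M[C]_n, B ^t* = B ->
    (forall i j, `|B i j - A i j| <= eta) ->
    negative_on B (count (fun x => (x < 0)%R) s).
Proof.
move=> hA As; have [W [e [e0 rW neg]]] := negative_onW hA As.
pose N : C := (n * n)%:R + 1.
have N0 : 0 < N by rewrite ltr_wpDl.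
exists (e / N) => [|B hB AB]; first by rewrite divr_gt0.
exists W => // u uW u0; have q0 := qform1_gt0 u0.
have -> : B = A + (B - A) by rewrite addrC subrK.
rewrite qformD; apply: le_lt_trans (_ : - e * qform 1%:M u + e / N * (n * n)%:R * qform 1%:M u < 0).
  apply: lerD; first exact: neg.
  apply: le_trans (real_ler_norm _) _.
    by apply: qform_real; rewrite raddfB map_mxB hA hB.
  rewrite qformE; apply: le_trans (ler_norm_sum _ _ _) _.
  have ui k : `|u 0 k| ^+ 2 <= qform 1%:M u.
    rewrite qform1E (bigD1 k)//= lerDl; apply: sumr_ge0 => l _.
    exact: exprn_ge0.
  have uij i j : `|u 0 i| * `|u 0 j| <= qform 1%:M u.
    rewrite -(@ler_pXn2r _ 2) ?nnegrE ?mulr_ge0 ?(ltW q0)// exprMn.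
    by rewrite [leRHS]expr2 ler_pM ?exprn_ge0.
  have -> : e / N * (n * n)%:R * qform 1%:M u =
      \sum_(i < n) \sum_(j < n) e / N * qform 1%:M u.
    rewrite !sumr_const !card_ord -mulrnA -[RHS]mulr_natr.
    by rewrite mulrAC.
  apply: ler_sum => i _; apply: le_trans (ler_norm_sum _ _ _) _.
  apply: ler_sum => j _; rewrite !normrM norm_conjC mulrAC mulrC.
  by apply: ler_pM => //; rewrite ?mulr_ge0// !mxE; exact: AB.
rewrite -mulrDl pmulr_llt0// addrC subr_lt0 mulrAC ltr_pdivrMr//.
by rewrite ltr_pM2l// /N ltrDl.
Qed.
End NegativeIndex.

(** * Number of negative eigenvalues of Pick matrices *)

Section NumNeg.
Local Open Scope sesquilinear_scope.
Variable R : realType.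
Local Notation C := R[i].

Lemma char_poly_eigenvalues n (A : 'M[C]_n) :
  char_poly A = \prod_(x <- eigenvalues A) ('X - x%:P).
Proof.
rewrite /eigenvalues; case: closed_field_poly_normal => s /= {1}->.
by rewrite (monicP (char_poly_monic A)) scale1r.
Qed.

Lemma num_neg_ge n (A : 'M[C]_n) r : A ^t* = A -> negative_on A r ->
  (r <= num_neg_eigenvalues A)%N.
Proof. by move=> hA; apply: negative_on_le => //; exact: char_poly_eigenvalues. Qed.

Lemma num_neg_robust n (A : 'M[C]_n) : A ^t* = A ->
  exists2 eta : C, 0 < eta & forall B : 'M[C]_n, B ^t* = B ->
    (forall i j, `|B i j - A i j| <= eta) ->
    (num_neg_eigenvalues A <= num_neg_eigenvalues B)%N.
Proof.
move=> hA; have [eta eta0 H] := negative_on_robust hA (char_poly_eigenvalues A).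
exists eta; first exact: eta0.
by move=> B hB BA; apply: (num_neg_ge hB); exact: H.
Qed.

Lemma negative_on_num_neg n (A : 'M[C]_n) : A ^t* = A ->
  negative_on A (num_neg_eigenvalues A).
Proof.
move=> hA; have [eta eta0 H] := negative_on_robust hA (char_poly_eigenvalues A).
by apply: H => // i j; rewrite subrr normr0 ltW.
Qed.

Lemma hermitianD n (A B : 'M[C]_n) : A ^t* = A -> B ^t* = B ->
  (A + B) ^t* = A + B.
Proof. by move=> hA hB; rewrite raddfD map_mxD hA hB. Qed.

Lemma hermitian_const n (d : R) : d%:C *: const_mx 1 = (d%:C *: const_mx 1 : 'M[C]_n) ^t*.
Proof. by apply/matrixP => i j; rewrite !mxE mulr1; exact/esym/conjc_real. Qed.

Lemma num_neg_diag n (A B : 'M[C]_n) (d : 'I_n -> C) :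
  A ^t* = A -> B ^t* = B -> (forall i, d i != 0) ->
  (forall i j, B i j = d i * A i j * (d j)^*) ->
  (num_neg_eigenvalues B <= num_neg_eigenvalues A)%N.
Proof.
move=> hA hB d0 BA; apply: num_neg_ge => //.
pose D : 'M[C]_n := diag_mx (\row_i d i).
have Dfree : row_free D.
  rewrite row_free_unit unitmxE det_diag unitfE prodf_seq_neq0.
  by apply/allP => i _; rewrite mxE d0.
apply: (negative_on_congr Dfree).
suff -> : D *m A *m D ^t* = B by exact: negative_on_num_neg.
rewrite /D tr_diag_mx map_diag_mx mul_mx_diag mul_diag_mx.
by apply/matrixP => i j; rewrite !mxE BA.
Qed.

Lemma sub_conj_neq0 (a b : C) : 0 < complex.Im a -> 0 < complex.Im b ->
  a - Num.conj b != 0.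
Proof.
move: a b => [a1 a2] [b1 b2] /= a0 b0; rewrite eq_complex /= negb_and orbC.
by rewrite opprK gt_eqF// addr_gt0.
Qed.

Lemma pick_hermitian (f : C -> sphere R) n (z : 'I_n -> C) :
  (pick_matrix f z) ^t* = pick_matrix f z.
Proof.
apply/matrixP => i j; rewrite !mxE fmorph_div !rmorphB /= !conjCK.
by rewrite -opprB -[X in _ / X]opprB invrN mulrNN.
Qed.

End NumNeg.

(** * Meromorphic functions on the upper half-plane *)

Section Holomorphy.
Local Open Scope classical_set_scope.
Local Open Scope ring_scope.
Local Open Scope complex_scope.
Local Open Scope sesquilinear_scope.
Variable R : realType.
Local Notation C := R[i].
Implicit Types (f g : C -> sphere R) (z : C).

Lemma sinvK : involutive (@sinv R).
Proof.
case=> [x|] /=; last by rewrite eqxx.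
by case: eqP => [->//|/eqP x0] /=; rewrite invr_eq0 (negPf x0) invrK.
Qed.

Lemma Im_le_norm (x : C) : (complex.Im x)%:C <= `|x|.
Proof.
rewrite -[complex.Im x]opprK -ReiNIm; apply: le_trans (_ : `|complex.Re (x * 'i%C)|%:C <= _).
  by rewrite lecR -normrN ler_norm.
by rewrite (le_trans (normc_ge_Re _))// normrM complexiE normCi mulr1.
Qed.

Lemma near_upper z0 : 0 < complex.Im z0 ->
  \forall z \near (z0 : C^o), 0 < complex.Im z.
Proof.
move=> z00.
have idc : (id : C^o -> C^o) @ (z0 : C^o) --> (z0 : C^o) by exact: cvg_id.
have := cvgr_dist_lt _ _ idc (complex.Im z0)%:C; rewrite ltcR => /(_ _ z00); apply: filterS => z /(le_lt_trans (Im_le_norm _)).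
by rewrite ltcR raddfB /= ltrBlDr ltrDl.
Qed.

(** Writing [f] with an explicit formula near the point replaces the computation
    of derivatives of [finval]. *)
Lemma holomorphicI f (phi : C -> C) z0 :
  (\forall z \near (z0 : C^o),
     f z = Some (phi z) /\ derivable (phi : C^o -> C^o) (z : C^o) 1) ->
  holomorphic_at f z0.
Proof.
move=> /near_join; apply: filterS => z zf; split.
  by have [-> _] := nbhs_singleton zf.
apply: (near_eq_derivable _ (nbhs_singleton zf).2); apply: filterS zf.
by move=> w [-> _].
Qed.

Lemma holomorphicE f z0 : holomorphic_at f z0 ->
  \forall z \near (z0 : C^o), f z = Some (finval (f z)) /\
    derivable ((fun x => finval (f x)) : C^o -> C^o) (z : C^o) 1.
Proof. by apply: filterS => z; case: (f z) => [x|] [//]. Qed.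

Lemma derivable_cvg (phi : C -> C) z0 :
  derivable (phi : C^o -> C^o) (z0 : C^o) 1 ->
  (phi : C^o -> C^o) @ (z0 : C^o) --> (phi z0 : C^o).
Proof. by move=> /derivable1_diffP /differentiable_continuous. Qed.

Lemma holomorphic_cvg f z0 : holomorphic_at f z0 ->
  ((fun z => finval (f z)) : C^o -> C^o) @ (z0 : C^o) --> (finval (f z0) : C^o).
Proof. by move=> /nbhs_singleton[_ /derivable_cvg]. Qed.

Lemma holomorphic_sinv f z0 : holomorphic_at f z0 -> f z0 <> Some 0 ->
  holomorphic_at (fun z => sinv (f z)) z0.
Proof.
move=> fh f0; have fc := holomorphic_cvg fh.
have [fz0 _] := nbhs_singleton (holomorphicE fh).
have phi0 : finval (f z0) != 0.
  by apply/eqP => e; apply: f0; rewrite fz0 e.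
have near0 : \forall z \near (z0 : C^o), finval (f z) != 0.
  exact: (cvgr_neq0 _ fc).
apply: (@holomorphicI _ (fun z => (finval (f z))^-1)).
apply: filterS2 near0 (holomorphicE fh) => z fz [-> fd]; split => /=.
  by rewrite (negPf fz).
exact: (derivableV fz fd).
Qed.

(** If only [1/f] is known to be holomorphic, it does not vanish at a point where
    [f] is finite, so [f = 1/(1/f)] is holomorphic there. *)
Lemma meromorphic_finite f z0 : meromorphic_upper f -> 0 < complex.Im z0 ->
  f z0 <> None -> holomorphic_at f z0.
Proof.
move=> fm z00 fz0; have [//|[fh _]] := fm _ z00.
have -> : f = (fun z => sinv (sinv (f z))) by apply/funext => z; rewrite sinvK.
apply: holomorphic_sinv => // /(congr1 (@sinv R)).
by rewrite sinvK /= eqxx.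
Qed.

Lemma meromorphic_pole f z0 : meromorphic_upper f -> 0 < complex.Im z0 ->
  f z0 = None -> holomorphic_at (fun z => sinv (f z)) z0.
Proof.
move=> fm z00 fz0; have [fh|[fh _]] := fm _ z00; last exact: fh.
have [fz _] := nbhs_singleton (holomorphicE fh).
rewrite fz0 in fz.
discriminate.
Qed.

Lemma poles_isolated f z0 : meromorphic_upper f -> 0 < complex.Im z0 ->
  \forall z \near ((z0 : C^o)^')%classic, f z <> None.
Proof.
move=> fm z00; have [fh|[]//] := fm _ z00.
by apply: nbhs_dnbhs; apply: filterS fh => z [].
Qed.

(** At each point only the chart of the sphere in which the value is finite has
    to be considered. *)
Lemma meromorphicI f :
  (forall z0, 0 < complex.Im z0 -> f z0 <> None -> holomorphic_at f z0) ->
  (forall z0, 0 < complex.Im z0 -> f z0 = None ->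
     holomorphic_at (fun z => sinv (f z)) z0) ->
  (forall z0, 0 < complex.Im z0 ->
     \forall z \near ((z0 : C^o)^')%classic, f z <> None) ->
  meromorphic_upper f.
Proof.
move=> f1 f2 f3 z0 z00; case E : (f z0) => [x|].
  by left; apply: f1 => //; rewrite E.
by right; split; [exact: f2|exact: f3].
Qed.

Lemma meromorphic_sadd f (p : C -> C) : meromorphic_upper f ->
  (forall z, derivable (p : C^o -> C^o) (z : C^o) 1) ->
  meromorphic_upper (fun z => sadd (p z) (f z)).
Proof.
move=> fm pd; apply: meromorphicI => z0 z00.
- move=> gz0; have fz0 : f z0 <> None by move: gz0; case: (f z0).
  have fh := meromorphic_finite fm z00 fz0.
  apply: (@holomorphicI _ (fun z => p z + finval (f z))).
  apply: filterS (holomorphicE fh) => z [-> fd]; split; first by [].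
  exact: (derivableD (pd z) fd).
(* At a pole put [h = 1/f]: then [1/(p + f) = h / (1 + p h)] with [h z0 = 0]. *)
- move=> gz0; have fz0 : f z0 = None by move: gz0; case: (f z0).
  have hh := meromorphic_pole fm z00 fz0.
  set h := fun z => sinv (f z) in hh.
  have qd z : derivable ((fun x => finval (h x)) : C^o -> C^o) (z : C^o) 1 ->
      derivable ((fun z => 1 + p z * finval (h z)) : C^o -> C^o) (z : C^o) 1.
    by move=> hd; exact: (derivableD (derivable_cst _ _ _) (derivableM (pd z) hd)).
  have cv := derivable_cvg (qd _ (nbhs_singleton (holomorphicE hh)).2).
  have near0 : \forall z \near (z0 : C^o), 1 + p z * finval (h z) != 0.
    apply: (cvgr_neq0 _ cv).
    by rewrite /h fz0 /= mulr0 addr0 oner_eq0.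
  apply: (@holomorphicI _ (fun z => finval (h z) / (1 + p z * finval (h z)))).
  apply: filterS2 near0 (holomorphicE hh) => z hz [hE hd]; split.
    move: hE hz; rewrite /h; case: (f z) => [w|] /=.
      case: eqP => [//|/eqP w0] _ /= hz.
      have pw : p z + w != 0.
        apply: contraNneq hz => pw0.
        have -> : 1 + p z / w = (p z + w) / w by field.
        by rewrite pw0 mul0r.
      rewrite (negPf pw); congr Some; field.
      by rewrite w0 addrC pw.
    by rewrite /= mul0r.
  apply: (derivableM hd); apply: (derivableV hz).
  exact: qd.
- apply: filterS (poles_isolated fm z00) => z; by case: (f z).
Qed.

Lemma meromorphic_sscale f (c : R) : meromorphic_upper f -> c != 0 ->
  meromorphic_upper (fun z => sscale c (f z)).
Proof.
move=> fm c0; have c0' : c%:C != 0 by rewrite fmorph_eq0.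
apply: meromorphicI => z0 z00.
- move=> gz0; have fz0 : f z0 <> None by move: gz0; case: (f z0).
  have fh := meromorphic_finite fm z00 fz0.
  apply: (@holomorphicI _ (fun z => c%:C * finval (f z))).
  apply: filterS (holomorphicE fh) => z [-> fd]; split; first by [].
  exact: (derivableM (derivable_cst (_ : C^o) _ _) fd).
- move=> gz0; have fz0 : f z0 = None by move: gz0; case: (f z0).
  have fh := meromorphic_pole fm z00 fz0.
  apply: (@holomorphicI _ (fun z => (c%:C)^-1 * finval (sinv (f z)))).
  apply: filterS (holomorphicE fh) => z [hE fd]; split; last exact: (derivableM (derivable_cst (_ : C^o) _ _) fd).
  move: hE; case: (f z) => [w|] /=; last by rewrite mulr0.
  by case: eqP => // /eqP w0 _; rewrite mulf_eq0 (negPf c0') (negPf w0)/= invfM.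
- apply: filterS (poles_isolated fm z00) => z; by case: (f z).
Qed.

(** The hypothesis on zeros is the isolation of the poles of [1/f]; it excludes
    [f = 0]. *)
Lemma meromorphic_sinv f : meromorphic_upper f ->
  (forall z0, 0 < complex.Im z0 ->
     \forall z \near ((z0 : C^o)^')%classic, f z <> Some 0) ->
  meromorphic_upper (fun z => sinv (f z)).
Proof.
move=> fm f0; apply: meromorphicI => z0 z00.
- case E : (f z0) => [w|] => [wN|_]; last exact: meromorphic_pole.
  apply: holomorphic_sinv; first by apply: meromorphic_finite => //; rewrite E.
  by rewrite E => -[w0]; apply: wN; rewrite w0 /= eqxx.
- case E : (f z0) => [w|//] wN.
  have -> : (fun z => sinv (sinv (f z))) = f by apply/funext => z; rewrite sinvK.
  by apply: meromorphic_finite => //; rewrite E.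
- apply: filterS (f0 _ z00) => z fz e; apply: fz.
  by rewrite -[f z]sinvK e.
Qed.

Lemma cvg_translate z0 :
  (fun s : C^o => (z0 + s : C^o)) @ (0 : C^o) --> (z0 : C^o).
Proof.
rewrite -[X in _ --> X]addr0.
have d : derivable ((fun s => z0 + s) : C^o -> C^o) (0 : C^o) 1.
  by apply: derivableD; [exact: derivable_cst|exact: derivable_id].
exact: (derivable_cvg d).
Qed.

Lemma near_shift (P : C -> Prop) z0 :
  (\forall z \near ((z0 : C^o)^')%classic, P z) ->
  \forall s \near ((0 : C^o)^')%classic, P (z0 + s).
Proof.
move=> Pz.
have H : \forall s \near (0 : C^o), z0 + s != z0 -> P (z0 + s).
  exact: (@cvg_translate z0 _ Pz).
suff : \forall s \near (0 : C^o), s != 0 -> P (z0 + s) by [].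
apply: filterS H => s Hs s0; apply: Hs.
by rewrite -subr_eq0 addrC addKr.
Qed.

Lemma num_neg_lsc (T : Type) (F : set_system T) n (A : 'M[C]_n) (B : T -> 'M[C]_n) :
  Filter F -> A ^t* = A -> (forall t, (B t) ^t* = B t) ->
  (forall i j, (fun t => (B t i j : C^o)) @ F --> (A i j : C^o)) ->
  \forall t \near F, (num_neg_eigenvalues A <= num_neg_eigenvalues (B t))%N.
Proof.
move=> FF hA hB cv; have [eta eta0 H] := num_neg_robust hA.
have : \forall t \near F, forall i j, `|B t i j - A i j| <= eta.
  apply: filter_forall => i; apply: filter_forall => j.
  by apply: filterS (cvgr_distC_le _ _ (cv i j) eta eta0).
by apply: filterS => t /(H _ (hB t)).
Qed.

(** A generic perturbation of the points costs no negative eigenvalue.  All the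
    points are translated by the same small [s], so that one filter on [s]
    controls the whole Pick matrix. *)
Lemma shift_points f (P : C -> Prop) n (z : 'I_n -> C) :
  meromorphic_upper f ->
  (forall z0, 0 < complex.Im z0 -> f z0 <> None ->
     \forall z \near ((z0 : C^o)^')%classic, P z) ->
  admissible_points f z ->
  exists z' : 'I_n -> C, [/\ admissible_points f z', forall k, P (z' k) &
    (num_neg_eigenvalues (pick_matrix f z) <=
     num_neg_eigenvalues (pick_matrix f z'))%N].
Proof.
move=> fm Piso zadm.
have fh k : holomorphic_at f (z k) by have [z0 fz] := zadm k; exact: meromorphic_finite.
have cvz k : (fun s : C^o => (z k + s : C^o)) @ ((0 : C^o)^')%classic --> (z k : C^o).
  by apply: cvg_within_filter; exact: cvg_translate.
have cvf k : (fun s : C^o => (finval (f (z k + s)) : C^o)) @ ((0 : C^o)^')%classic -->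
    (finval (f (z k)) : C^o).
  exact: cvg_comp (cvz k) (holomorphic_cvg (fh k)).
have conjc (F : set_system C^o) (FF : Filter F) (u : C^o -> C^o) (l : C^o) : u @ F --> l ->
    (fun s => (Num.conj (u s) : C^o)) @ F --> (Num.conj l : C^o).
  move=> /cvgrPdist_lt ul; apply/cvgrPdist_lt => e e0.
  by apply: filterS (ul e e0) => s; rewrite -rmorphB norm_conjC.
have H1 : \forall s \near ((0 : C^o)^')%classic,
   (num_neg_eigenvalues (pick_matrix f z) <=
    num_neg_eigenvalues (pick_matrix f (fun k => (z k + s)%R)))%N.
  apply: num_neg_lsc; [exact: pick_hermitian|move=> s; exact: pick_hermitian|].
  move=> i j; rewrite mxE; under eq_fun do rewrite mxE.
  apply: (@cvgM C).
    apply: (@cvgB _ C^o); first exact: cvf.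
    by apply: conjc; exact: cvf.
  apply: (@cvgV C).
    by apply: sub_conj_neq0; have [] := zadm i; have [] := zadm j.
  apply: (@cvgB _ C^o); first exact: cvz.
  by apply: conjc; exact: cvz.
have H2 : \forall s \near ((0 : C^o)^')%classic,
   forall k, [/\ 0 < complex.Im (z k + s), f (z k + s) <> None & P (z k + s)].
  apply: filter_forall => k; have [z0 fz] := zadm k.
  apply: (@near_shift (fun z => [/\ 0 < complex.Im z, f z <> None & P z])).
  apply: filterS3 (nbhs_dnbhs (near_upper z0)) (poles_isolated fm z0) (Piso _ z0 fz).
  by move=> s.
have H12 : \forall s \near ((0 : C^o)^')%classic,
   (num_neg_eigenvalues (pick_matrix f z) <=
    num_neg_eigenvalues (pick_matrix f (fun k => (z k + s)%R)))%N /\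
   forall k, [/\ 0 < complex.Im (z k + s), f (z k + s) <> None & P (z k + s)].
  by apply: filterS2 H1 H2 => s; split.
have [s [le_s Hs]] := @filter_ex _ _ (Proper_dnbhs_numFieldType (0 : C)) _ H12.
exists (fun k => z k + s); split; last exact: le_s.
  by move=> k; have [] := Hs k.
by move=> k; have [] := Hs k.
Qed.

End Holomorphy.

(** * Zeros of functions with bounded Pick matrices *)

Section Zeros.
Local Open Scope classical_set_scope.
Local Open Scope ring_scope.
Local Open Scope complex_scope.
Local Open Scope sesquilinear_scope.
Variable R : realType.
Local Notation C := R[i].
Implicit Types (f g : C -> sphere R) (z : C).

Definition pick_bounded k f : Prop := forall (n : nat) (z : 'I_n -> C),
  (0 < n)%N -> admissible_points f z ->
  (num_neg_eigenvalues (pick_matrix f z) <= k)%N.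

(** On the zeros [s i] the Pick matrix vanishes, and the block between zeros
    and nonzero points [w j] is a Cauchy matrix with scaled columns, hence
    invertible: the Pick matrix at all these points is hyperbolic. *)
Lemma few_zeros f k N (s w : 'I_N -> C) : pick_bounded k f -> (0 < N)%N ->
  injective s -> injective w ->
  (forall i, 0 < complex.Im (s i) /\ f (s i) = Some 0) ->
  (forall i, 0 < complex.Im (w i) /\ exists2 c, f (w i) = Some c & c != 0) ->
  (N <= k)%N.
Proof.
move=> fk N0 sI wI fs fw.
pose z : 'I_(N + N) -> C := fun i => match fintype.split i with inl a => s a | inr b => w b end.
have zl a : z (lshift N a) = s a.
  by rewrite /z; have := unsplitK (inl a : 'I_N + 'I_N) => /= ->.
have zr b : z (rshift N b) = w b.
  by rewrite /z; have := unsplitK (inr b : 'I_N + 'I_N) => /= ->.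
have zadm : admissible_points f z.
  move=> i; rewrite /z; case: fintype.split => a.
    by have [? ->] := fs a.
  by have [? [c ->]] := fw a.
apply: leq_trans (fk _ z _ zadm); last by rewrite addn_gt0 N0.
apply: num_neg_ge; first exact: pick_hermitian.
pose A := pick_matrix f w.
pose B : 'M[C]_N := \matrix_(i, j) ((0 - Num.conj (finval (f (w j)))) / (s i - Num.conj (w j))).
have -> : pick_matrix f z = block_mx 0 B (B ^t*) A.
  apply/matrixP => i j; rewrite -(splitK i) -(splitK j).
  case: (fintype.split i) => a; case: (fintype.split j) => b /=.
  - rewrite block_mxEul !mxE !zl; have [_ ->] := fs a; have [_ ->] := fs b.
    by rewrite /= rmorph0 subrr mul0r.
  - by rewrite block_mxEur !mxE zl zr; have [_ ->] := fs a.
  - rewrite block_mxEdl !mxE zl zr; have [_ ->] := fs b.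
    rewrite /= rmorph0 subr0 fmorph_div !rmorphB /= !conjCK rmorph0 sub0r.
    by rewrite -[X in _ / X]opprB invrN mulrNN.
  - by rewrite block_mxEdr !mxE !zr.
apply: negative_on_hyperbolic; first exact: pick_hermitian.
rewrite -row_free_unit -kermx_eq0; apply/rowV0P => v /sub_kermxP vB.
apply/rowP => i; rewrite [RHS]mxE.
apply: (@cauchy_kernel_free _ _ s (fun j => Num.conj (w j)) (fun i => v 0 i)) => //.
- by move=> a b /(can_inj (@conjCK _))/wI.
- move=> a b; rewrite -opprB oppr_eq0.
  by apply: sub_conj_neq0; [have [] := fs a|have [] := fw b].
move=> j; have [_ [c fwj c0]] := fw j.
have : (v *m B) 0 j = 0 by rewrite vB mxE.
rewrite mxE => e.
have c0' : Num.conj c != 0 by rewrite conjC_eq0.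
apply: (mulfI c0'); rewrite mulr0 -[RHS]e mulr_sumr; apply: eq_bigr => l _.
rewrite mxE fwj /= sub0r -[X in _ = _ * (_ / X)]opprB invrN mulrNN.
by rewrite mulrCA.
Qed.

(** Replaces the identity theorem: by the previous lemma there are only finitely
    many zeros at all. *)
Lemma zeros_isolated f k : pick_bounded k f ->
  (forall N, exists2 w : 'I_N -> C, injective w &
    forall i, 0 < complex.Im (w i) /\ exists2 c, f (w i) = Some c & c != 0) ->
  forall z0, 0 < complex.Im z0 ->
    \forall z \near ((z0 : C^o)^')%classic, f z <> Some 0.
Proof.
move=> fk nz z0 z00.
have [r rP] : exists r : seq C, forall z, 0 < complex.Im z -> f z = Some 0 -> z \in r.
  apply: contrapT => norm.
  have H n : exists r : seq C, [/\ uniq r, size r = n &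
      forall z, z \in r -> 0 < complex.Im z /\ f z = Some 0].
    elim: n => [|n [r [ur sr rP]]]; first by exists [::].
    have [z [zU fz zr]] : exists z, [/\ 0 < complex.Im z, f z = Some 0 & z \notin r].
      apply: contrapT => nz'; apply: norm; exists r => z zU fz.
      by apply/negPn/negP => zr; apply: nz'; exists z.
    exists (z :: r); split; rewrite /= ?ur ?zr ?sr//.
    by move=> z'; rewrite inE => /orP[/eqP ->|/rP].
  have [r [ur sr rP]] := H k.+1; have [w wI fw] := nz k.+1.
  have : (k.+1 <= k)%N; last by rewrite ltnn.
  apply: (few_zeros (s := fun i : 'I_k.+1 => r`_i) fk _ _ wI _ fw) => //.
    move=> i j /eqP; rewrite nth_uniq ?sr// => /eqP; exact: val_inj.
  by move=> i; apply: rP; rewrite mem_nth ?sr.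
have nr : \forall z \near ((z0 : C^o)^')%classic, z \notin r.
  elim: r {rP} => [|a r IH]; first exact: nearW.
  have na : \forall z \near ((z0 : C^o)^')%classic, z != a.
    have [<-|za] := eqVneq z0 a; first exact: nbhs_dnbhs_neq.
    apply: nbhs_dnbhs.
    have idc : (id : C^o -> C^o) @ (z0 : C^o) --> (z0 : C^o) by exact: cvg_id.
    have /cvgrPdist_lt/(_ `|z0 - a|) := idc; rewrite normr_gt0 subr_eq0 => /(_ za).
    by apply: filterS => z; apply: contraTneq => ->; rewrite ltxx.
  apply: filterS2 na IH => z za zr; rewrite inE negb_or za; exact: zr.
apply: filterS2 nr (nbhs_dnbhs (near_upper z00)) => z zr zU fz.
by rewrite (rP _ zU fz) in zr.
Qed.

End Zeros.

(** * Adding a linear term *)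

Section Steps.
Local Open Scope classical_set_scope.
Local Open Scope ring_scope.
Local Open Scope complex_scope.
Local Open Scope sesquilinear_scope.
Variable R : realType.
Local Notation C := R[i].
Implicit Types (f g : C -> sphere R) (z : C).

Lemma num_neg_addconst_le n (A : 'M[C]_n) (d : R) : A ^t* = A -> d = 1 \/ d = -1 ->
  (num_neg_eigenvalues (A + d%:C *: const_mx 1)%R <=
   num_neg_eigenvalues A + (d < 0)%R)%N.
Proof.
move=> hA hd; set B := (A + _)%R.
have hB : B ^t* = B by apply: hermitianD => //; exact/esym/hermitian_const.
have := negative_on_num_neg hB; rewrite {1}/B.
case: hd => ->.
  rewrite ltNge ler01 addn0 rmorph1 scale1r => /negative_on_subconst.
  exact: num_neg_ge.
rewrite ltrN10 addn1 rmorphN1 scaleN1r => /negative_on_addconst/(num_neg_ge hA).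
by rewrite -ltnS => /(leq_trans _); apply; exact: leqSpred.
Qed.

Lemma hermitian_pad n (A : 'M[C]_n) : A ^t* = A -> (pad_mx A) ^t* = pad_mx A.
Proof.
by move=> hA; rewrite /pad_mx tr_block_mx map_block_mx !trmx0 !map_mx0 hA.
Qed.

Lemma num_neg_pad_ge n (A : 'M[C]_n) (d : R) : A ^t* = A -> d = 1 \/ d = -1 ->
  (num_neg_eigenvalues A + (d < 0)%R <=
   num_neg_eigenvalues (pad_mx A + d%:C *: const_mx 1)%R)%N.
Proof.
move=> hA hd; apply: num_neg_ge.
  by apply: hermitianD; [exact: hermitian_pad|exact/esym/hermitian_const].
have := negative_on_num_neg hA; case: hd => ->.
  rewrite ltNge ler01 addn0 rmorph1 scale1r; exact: negative_on_pad_add.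
rewrite ltrN10 (addn1 (num_neg_eigenvalues A)) rmorphN1 scaleN1r; exact: negative_on_pad_sub.
Qed.

Definition affine (d b : R) (z : C) : C := d%:C * (z - b%:C).

Lemma derivable_affine d b z : derivable (affine d b : C^o -> C^o) (z : C^o) 1.
Proof.
have h : derivable ((fun z => z - b%:C) : C^o -> C^o) (z : C^o) 1.
  by apply: derivableD; [exact: derivable_id|exact: derivable_cst].
exact: (derivableM (derivable_cst (_ : C^o) _ _) h).
Qed.

Lemma conj_affine d b z : Num.conj (affine d b z) = affine d b (Num.conj z).
Proof.
rewrite /affine rmorphM rmorphB /=; congr (_ * (_ - _)); exact: conjc_real.
Qed.

Lemma admissible_sadd f (p : C -> C) n (z : 'I_n -> C) :
  admissible_points (fun z => sadd (p z) (f z)) z <-> admissible_points f z.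
Proof.
split=> adm k; have [zk fk] := adm k; split=> //; move: fk.
  by case: (f (z k)).
by case: (f (z k)).
Qed.

(** The difference quotient of the linear term is constantly [d], because [d] and
    [b] are real. *)
Lemma pick_affine f d b n (z : 'I_n -> C) : admissible_points f z ->
  pick_matrix (fun z => sadd (affine d b z) (f z)) z =
  pick_matrix f z + d%:C *: const_mx 1.
Proof.
move=> adm; apply/matrixP => i j; rewrite !mxE mulr1.
have [zi fi] := adm i; have [zj fj] := adm j.
have zij := sub_conj_neq0 zi zj.
move: fi fj; case: (f (z i)) => // u _; case: (f (z j)) => // v _ /=.
rewrite rmorphD /= conj_affine /affine; field; exact: zij.
Qed.

Lemma Im_sub_conj (a b : C) : complex.Im (a - Num.conj b) = complex.Im a + complex.Im b.
Proof. by case: a => a1 a2; case: b => b1 b2 /=; rewrite opprK. Qed.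

Lemma pick_entry_small (u v a b : C) (e y : R) : 0 < y -> 0 <= e ->
  `|u| <= (e * y)%:C -> `|v| <= (e * y)%:C ->
  y <= complex.Im a + complex.Im b ->
  `|(u - Num.conj v) / (a - Num.conj b)| <= (e + e)%:C.
Proof.
move=> y0 e0 ue ve yab; rewrite normf_div.
have ab : y%:C <= `|a - Num.conj b|.
  by apply: le_trans (Im_le_norm _); rewrite Im_sub_conj lecR.
have ab0 : 0 < `|a - Num.conj b| by apply: lt_le_trans ab; rewrite ltcR.
rewrite ler_pdivrMr//; apply: le_trans (ler_normB _ _) _; rewrite norm_conjC.
apply: le_trans (lerD ue ve) _.
rewrite -rmorphD -mulrDl rmorphM; apply: ler_pM => //.
- by rewrite lecR addr_ge0.
- by rewrite lecR ltW.
Qed.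

Lemma entry_sub_addr n (A B D : 'M[C]_n) i j :
  (A + D) i j - (B + D) i j = A i j - B i j.
Proof. by rewrite !mxE opprD addrACA subrr addr0. Qed.

(** The upper bound is the effect of a rank one perturbation.  For the lower
    bound one point [i y] with large [y] is added to points that realize [k]:
    since [f(iy) = o(y)], the Pick matrix is close to [pad_mx] of the old one,
    plus the rank one matrix, and negative eigenvalues survive. *)
Lemma nevanlinna_affine k f d b : d = 1 \/ d = -1 ->
  nevanlinna k f -> littleo_imag_axis f ->
  nevanlinna (k + (d < 0)%R) (fun z => sadd (affine d b z) (f z)).
Proof.
move=> hd [fm fs fb [n [z [n0 zadm zk]]]] fo; set g := fun z => _.
have gb : forall (n : nat) (z : 'I_n -> C), (0 < n)%N -> admissible_points g z ->
    (num_neg_eigenvalues (pick_matrix g z) <= k + (d < 0)%R)%N.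
  move=> p w p0 /admissible_sadd wadm; rewrite pick_affine//.
  apply: leq_trans (num_neg_addconst_le (pick_hermitian _ _) hd) _.
  by rewrite leq_add2r; exact: fb.
split=> //.
- by apply: meromorphic_sadd => //; exact: derivable_affine.
- move=> w wU; rewrite /g fs//.
  by case: (f w) => //= x; rewrite rmorphD /= conj_affine.
pose L := pad_mx (pick_matrix f z) + d%:C *: const_mx 1.
have hL : L ^t* = L.
  apply: hermitianD; last exact/esym/hermitian_const.
  exact: hermitian_pad (pick_hermitian f z).
have [eta eta0 HL] := num_neg_robust hL.
have [e e0 etaE] : exists2 e : R, 0 < e & eta = (e + e)%:C.
  exists (complex.Re eta / 2).
    by move: eta0; rewrite ltcE /= => /andP[_ ?]; rewrite divr_gt0.
  rewrite -splitr RRe_real// gtr0_real//.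
(* [K] bounds the values of [f] at the old points, so that [K <= e y] puts
   them on the same scale as [f(iy)]. *)
pose K := \sum_j complex.Re `|finval (f (z j))|.
have zK j : `|finval (f (z j))| <= K%:C.
  rewrite -[leLHS]RRe_real ?normr_real// lecR /K (bigD1 j)//= lerDl.
  apply: sumr_ge0 => i _; have := normr_ge0 (finval (f (z i))).
  by rewrite lecE => /andP[].
have [y [y0 Ky [w fy wy]]] : exists y : R, [/\ 0 < y, K <= e * y &
    exists2 w : C, f (0 +i* y) = Some w & `|w| <= (e * y)%:C].
  have H1 : \forall y \near +oo, (0:R) < y by exact: nbhs_pinfty_gt (num_real _).
  have H2 : \forall y \near +oo, (K / e : R) <= y by exact: nbhs_pinfty_ge (num_real _).
  have [y [[y0 Ky] Hy]] := filter_ex (filterI (filterI H1 H2) (fo e e0)).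
  by exists y; split => //; rewrite mulrC -ler_pdivrMr.
pose z' : 'I_(n + 1) -> C := fun i =>
  match fintype.split i with inl a => z a | inr _ => 0 +i* y end.
have zl a : z' (lshift 1 a) = z a.
  by rewrite /z'; have := unsplitK (inl a : 'I_n + 'I_1) => /= ->.
have zr a : z' (rshift n a) = 0 +i* y.
  by rewrite /z'; have := unsplitK (inr a : 'I_n + 'I_1) => /= ->.
have zadm' : admissible_points f z'.
  move=> i; rewrite /z'; case: fintype.split => a; first exact: zadm.
  by rewrite fy.
exists (n + 1)%N, z'; split; [by rewrite addn1|exact/admissible_sadd|].
apply/eqP; rewrite eqn_leq; apply/andP; split.
  by apply: gb; [rewrite addn1|exact/admissible_sadd].
rewrite -zk; apply: leq_trans (num_neg_pad_ge (pick_hermitian _ _) hd) _.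
rewrite (pick_affine _ _ zadm'); apply: HL.
  by apply: hermitianD; [exact: pick_hermitian|exact/esym/hermitian_const].
have fz a : `|finval (f (z a))| <= (e * y)%:C.
  by apply: le_trans (zK a) _; rewrite lecR.
move=> i j; rewrite /L entry_sub_addr etaE.
rewrite -(splitK i) -(splitK j) /pad_mx.
case: (fintype.split i) => a; case: (fintype.split j) => c /=.
- rewrite block_mxEul !mxE !zl subrr normr0 ler0c.
  by rewrite addr_ge0// ltW.
- rewrite block_mxEur !mxE zl zr fy subr0.
  apply: (pick_entry_small y0 (ltW e0)) => //=.
  by rewrite lerDr ltW//; have [] := zadm a.
- rewrite block_mxEdl !mxE zl zr fy subr0.
  apply: (pick_entry_small y0 (ltW e0)) => //=.
  by rewrite lerDl ltW//; have [] := zadm c.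
- rewrite block_mxEdr !mxE !zr fy subr0.
  apply: (pick_entry_small y0 (ltW e0)) => //=.
  by rewrite lerDl ltW.
Qed.

End Steps.

(** * Inversion *)

Section Inversion.
Local Open Scope classical_set_scope.
Local Open Scope ring_scope.
Local Open Scope complex_scope.
Local Open Scope sesquilinear_scope.
Variable R : realType.
Local Notation C := R[i].
Implicit Types (f g : C -> sphere R) (z : C).

(** What inversion needs to know: there are infinitely many points where [g] is
    finite and nonzero, and [1/g] is again o(y).  The factor 1/2 leaves room for
    the o(y) term next to the linear one. *)
Definition grows_linearly g : Prop :=
  \forall y \near +oo, exists2 w : C, g (0 +i* y) = Some w & (y / 2)%:C <= `|w|.

(** The imaginary part of [i y - b] is [y], and [|f(iy)| <= y / 2] eventually. *)
Lemma affine_grows f d b : d = 1 \/ d = -1 -> littleo_imag_axis f ->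
  grows_linearly (fun z => sadd (affine d b z) (f z)).
Proof.
move=> hd fo; have h2 : (0 : R) < 2^-1 by rewrite invr_gt0.
apply: filterS (fo _ h2) => y [w fy wy].
exists (affine d b (0 +i* y) + w); first by rewrite fy.
have dn : `|d%:C| = 1 :> C.
  by case: hd => ->; rewrite ?rmorph1 ?rmorphN1 ?normrN normr1.
have ay : y%:C <= `|affine d b (0 +i* y)|.
  rewrite /affine normrM dn mul1r; apply: le_trans (Im_le_norm _).
  by rewrite /= subr0.
rewrite -[affine _ _ _](addrK w) in ay.
have := le_trans ay (ler_normB _ _); rewrite -lerBlDr; apply: le_trans.
rewrite lerBrDl; apply: le_trans (lerD wy (lexx _)) _.
by rewrite -rmorphD lecR mulrC -splitr.
Qed.

Lemma grows_nonzeros g : grows_linearly g -> forall N, exists2 w : 'I_N -> C,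
  injective w & forall i, 0 < complex.Im (w i) /\ exists2 c, g (w i) = Some c & c != 0.
Proof.
move=> [M [_ HM]] N.
pose y (i : nat) : R := Num.max M 0 + 1 + i%:R.
have yM i : M < y i.
  by rewrite /y -addrA (le_lt_trans (_ : M <= Num.max M 0)) ?le_max ?lexx// ltrDl ltr_wpDr.
have y0 i : 0 < y i.
  by rewrite /y -addrA (le_lt_trans (_ : 0 <= Num.max M 0)) ?le_max ?lexx ?orbT// ltrDl ltr_wpDr.
exists (fun i : 'I_N => 0 +i* y i).
  by move=> i j [] /addrI/eqP; rewrite eqr_nat => /eqP/val_inj.
move=> i; split; first exact: y0.
have [w gw yw] := HM _ (yM i); exists w => //.
by rewrite -normr_gt0 (lt_le_trans _ yw)// ltcR divr_gt0.
Qed.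

Lemma littleo_sinv g c : grows_linearly g ->
  littleo_imag_axis (fun z => sscale c (sinv (g z))).
Proof.
move=> gg e e0.
have H1 : \forall y \near +oo, (1:R) <= y by exact: nbhs_pinfty_ge (num_real _).
have H2 : \forall y \near +oo, (2 * `|c| / e : R) <= y.
  exact: nbhs_pinfty_ge (num_real _).
apply: filterS3 gg H1 H2 => y [w gw yw] y1 ye.
have y0 : 0 < y by apply: lt_le_trans y1.
have w0 : 0 < `|w| by apply: lt_le_trans yw; rewrite ltcR divr_gt0.
exists (c%:C / w); first by rewrite gw /= -normr_eq0 (gt_eqF w0).
rewrite normf_div ler_pdivrMr//.
have -> : `|c%:C| = (`|c|)%:C :> C.
  by rewrite normc_def /= expr0n addr0 sqrtr_sqr.
apply: le_trans (_ : (e * y)%:C * (y / 2)%:C <= _).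
  rewrite -rmorphM lecR; rewrite ler_pdivrMr// in ye.
  have : y * e <= y * e * y by rewrite ler_peMr// mulr_ge0// ltW.
  by lra.
by apply: ler_wpM2l => //; rewrite ler0c mulr_ge0// ltW.
Qed.

(** The two Pick matrices are congruent by the diagonal matrix with entries
    [sqrt c / g(z_k)]. *)
Lemma pick_sinv g (c : R) n (z : 'I_n -> C) (w : 'I_n -> C) : 0 < c ->
  (forall k, w k != 0) -> (forall k, g (z k) = Some (w k)) ->
  num_neg_eigenvalues (pick_matrix (fun z => sscale (- c) (sinv (g z))) z) =
  num_neg_eigenvalues (pick_matrix g z).
Proof.
move=> c0 w0 gw; set H := pick_matrix (fun z => _) z; set G := pick_matrix g z.
pose s : C := (Num.sqrt c)%:C.
have s0 : s != 0 by rewrite fmorph_eq0 gt_eqF// sqrtr_gt0.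
have s2 : s * Num.conj s = c%:C.
  have -> : Num.conj s = s by exact: conjc_real.
  by rewrite -rmorphM -expr2 sqr_sqrtr// ltW.
have s0' : Num.conj s != 0 by rewrite conjC_eq0.
have w0' k : Num.conj (w k) != 0 by rewrite conjC_eq0.
have HG i j : H i j = s / w i * G i j * Num.conj (s / w j).
  rewrite !mxE !gw /= (negPf (w0 i)) (negPf (w0 j)) /= !rmorphN !mulNr.
  rewrite rmorphN /= rmorphM /= -s2 rmorphM /= conjCK !fmorphV.
  rewrite [RHS]mulrAC mulrA; congr (_ / _).
  by field; rewrite w0 w0'.
apply/eqP; rewrite eqn_leq; apply/andP; split.
  apply: (num_neg_diag (pick_hermitian _ _) (pick_hermitian _ _) _ HG) => i.
  by rewrite mulf_neq0 ?invr_eq0.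
apply: (@num_neg_diag _ _ _ _ (fun i => w i / s) (pick_hermitian _ _) (pick_hermitian _ _)).
  by move=> i; rewrite mulf_neq0 ?invr_eq0.
move=> i j; rewrite -/H -/G HG !fmorph_div; field.
by rewrite s0 s0' w0 w0'.
Qed.

(** The congruence applies only at points where [g] is finite and nonzero.
    Poles and zeros of [g] being isolated, all other points are avoided by
    translating them: the upper bound avoids poles of [g], the lower
    bound avoids zeros. *)
Lemma nevanlinna_sinv g k (c : R) : 0 < c -> grows_linearly g ->
  nevanlinna k g -> nevanlinna k (fun z => sscale (- c) (sinv (g z))).
Proof.
move=> c0 gg [gm gs gb [n [z [n0 zadm zk]]]]; set h := fun z => _.
have g0 := zeros_isolated gb (grows_nonzeros gg).
have hm : meromorphic_upper h.
  apply: meromorphic_sscale; last by rewrite oppr_eq0 gt_eqF.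
  exact: meromorphic_sinv.
have hb : pick_bounded k h.
  move=> p v p0 vadm.
  have Piso z0 : 0 < complex.Im z0 -> h z0 <> None ->
      \forall z \near ((z0 : C^o)^')%classic, g z <> None.
    by move=> z00 _; exact: poles_isolated.
  have [v' [vadm' gv le_v]] := shift_points hm Piso vadm.
  apply: leq_trans le_v _.
  have gE i : exists2 w, g (v' i) = Some w & w != 0.
    have [_] := vadm' i; have := gv i; rewrite /h.
    case: (g (v' i)) => // w _ hw; exists w => //.
    by apply/negP => /eqP w0; apply: hw; rewrite w0 /= eqxx.
  rewrite (pick_sinv (w := fun i => finval (g (v' i))) c0).
  - by apply: gb => // i; split; [have [] := vadm' i|exact: gv].
  - by move=> i; have [w -> w0] := gE i.
  - by move=> i; have [w -> w0] := gE i.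
split=> //.
  move=> z1 z1U; rewrite /h gs//; case: (g z1) => [w|] /=.
    rewrite conjC_eq0; case: eqP => //= _.
    by congr Some; rewrite rmorphM /= fmorphV; congr (_ / _); exact/esym/conjc_real.
  by rewrite !mulr0 rmorph0.
have [v [vadm gv le_v]] := shift_points gm (fun z0 z00 _ => g0 z0 z00) zadm.
have gE i : exists2 w, g (v i) = Some w & w != 0.
  have [_] := vadm i; have := gv i.
  case: (g (v i)) => // w w0 _; exists w => //.
  by apply/negP => /eqP e; apply: w0; rewrite e.
have hadm : admissible_points h v.
  move=> i; split; first by have [] := vadm i.
  by rewrite /h; have [w -> w0] := gE i; rewrite /= (negPf w0).
exists n, v; split; [exact: n0|exact: hadm|].
apply/eqP; rewrite eqn_leq (hb _ _ n0 hadm).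
rewrite (pick_sinv (w := fun i => finval (g (v i))) c0) -?zk//.
- by move=> i; have [w -> w0] := gE i.
- by move=> i; have [w -> w0] := gE i.
Qed.

End Inversion.

(** * The continued fraction *)

Section Recursion.
Variables (R : realType) (alpha beta : nat -> R) (eps : R) (m : nat).
Hypothesis alpha_neq0 : forall k : nat, (k <= m.*2)%N -> alpha k != 0.
Hypothesis heps : eps = 1 \/ eps = -1.
Local Notation C := R[i].
Local Notation eps_ := (cf_sign alpha eps m).

Lemma cf_sign_last : eps_ m.*2.+1 = eps.
Proof. by rewrite /cf_sign big_geq// sgr1 mulr1. Qed.

Lemma cf_sign_step j : (j <= m.*2)%N -> eps_ j = Num.sg (alpha j) * eps_ j.+1.
Proof. by move=> jm; rewrite /cf_sign big_ltn// sgrM mulrCA. Qed.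

Lemma cf_sign_pm j : eps_ j = 1 \/ eps_ j = -1.
Proof.
have p0 : \prod_(j <= k < m.*2.+1) alpha k != 0.
  rewrite big_nat_cond prodf_seq_neq0; apply/allP => k _; apply/implyP.
  by rewrite andbT => /andP[_ km]; apply: alpha_neq0.
rewrite /cf_sign; case: (sgrP (\prod_(j <= k < m.*2.+1) alpha k)) p0; rewrite ?eqxx//.
  by move=> _ _; rewrite mulr1.
by move=> _ _; rewrite mulrN1; case: heps => ->; rewrite ?opprK; [right|left].
Qed.

Lemma sscale_sscale (a b : R) (w : sphere R) : sscale a (sscale b w) = sscale (a * b) w.
Proof. by case: w => //= x; rewrite rmorphM mulrA. Qed.

Lemma sscale1 (w : sphere R) : sscale 1 w = w.
Proof. by case: w => //= x; rewrite rmorph1 mul1r. Qed.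

Lemma sscale_sadd (a : R) (p : C) (w : sphere R) :
  sscale a (sadd p w) = sadd (a%:C * p) (sscale a w).
Proof. by case: w => //= x; rewrite mulrDr. Qed.

Lemma sinv_sscale (a : R) (w : sphere R) : a != 0 ->
  sinv (sscale a w) = sscale a^-1 (sinv w).
Proof.
move=> a0; have a0' : a%:C != 0 by rewrite fmorph_eq0.
case: w => [x|] /=; last by rewrite mulr0.
rewrite mulf_eq0 (negPf a0') /=; case: eqP => //= _.
by rewrite invfM fmorphV.
Qed.

Lemma pm_sqr (e : R) : e = 1 \/ e = -1 -> e * e = 1.
Proof. by case=> ->; rewrite ?mulr1 ?mulrNN ?mulr1. Qed.

Lemma pm_inv (e : R) : e = 1 \/ e = -1 -> e^-1 = e.
Proof. by case=> ->; rewrite ?invr1 ?invrN1. Qed.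

Lemma sscale_sinv_pm (a e : R) (w : sphere R) : e = 1 \/ e = -1 ->
  sscale a (sinv w) = sscale (a * e) (sinv (sscale e w)).
Proof.
move=> he; rewrite sinv_sscale ?pm_inv// ?sscale_sscale -?mulrA ?pm_sqr ?mulr1//.
by case: he => ->; rewrite ?oppr_eq0 oner_eq0.
Qed.

(** This sign is the reason for the definition of the [eps_j]: it makes the
    normalized recursion a sequence of inversions [- c / g] with [c > 0]. *)
Lemma cf_sign_gt0 j : (j < m)%N ->
  0 < eps_ j.*2.+1 * (alpha j.*2.+1 * alpha j.*2.+2) * eps_ j.*2.+3.
Proof.
move=> jm.
have a1 : alpha j.*2.+1 != 0 by apply: alpha_neq0; rewrite ltn_double.
have a2 : alpha j.*2.+2 != 0 by apply: alpha_neq0; rewrite -doubleS leq_double.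
rewrite cf_sign_step; last by rewrite ltn_double.
rewrite cf_sign_step; last by rewrite -doubleS leq_double.
set e := eps_ _; rewrite (_ : _ * e =
  (Num.sg (alpha j.*2.+1) * alpha j.*2.+1) *
  (Num.sg (alpha j.*2.+2) * alpha j.*2.+2) * (e * e)); last by ring.
by rewrite pm_sqr ?mulr1 -?normrEsg ?mulr_gt0 ?normr_gt0//; exact: cf_sign_pm.
Qed.

Section Last.
Variables (lambda : nat) (psi : C -> sphere R).
Hypotheses (psiN : nevanlinna lambda psi) (psio : littleo_imag_axis psi).

(** The denominator [D_j] multiplied by [eps_(2j+1)] is a linear term with slope
    [eps_(2j+1)] plus a function that is o(y), whose index is [lambda] plus
    the number of negative slopes at the levels after [j]. *)
Lemma cf_denom_nevanlinna k j : (j + k = m)%N ->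
  exists f : C -> sphere R,
    [/\ nevanlinna (\sum_(j.+1 <= i < m.+1) (eps_ i.*2.+1 < 0)%R + lambda)%N f,
        littleo_imag_axis f &
        forall z, sscale (eps_ j.*2.+1) (cf_denom alpha beta eps psi k j z) =
          sadd (affine (eps_ j.*2.+1) (beta j) z) (f z)].
Proof.
elim: k j => [|k IH] j jk.
  move: jk; rewrite addn0 => ->; exists psi; split => //.
    by rewrite big_geq.
  by move=> z; rewrite sscale_sadd sscale_sscale cf_sign_last pm_sqr// sscale1.
have jm : (j < m)%N by rewrite -jk addnS ltnS leq_addr.
have [f [fN fo fE]] := IH j.+1 (etrans (addSnnS _ _) jk).
have e1 := cf_sign_pm j.+1.*2.+1.
have gE : (fun z => sscale (eps_ j.+1.*2.+1) (cf_denom alpha beta eps psi k j.+1 z)) =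
    (fun z => sadd (affine (eps_ j.+1.*2.+1) (beta j.+1) z) (f z)).
  exact/funext.
have gg := affine_grows (beta j.+1) e1 fo.
have := nevanlinna_affine (beta j.+1) e1 fN fo; rewrite -gE in gg *.
have <- : (\sum_(j.+1 <= i < m.+1) (eps_ i.*2.+1 < 0)%R + lambda =
    \sum_(j.+2 <= i < m.+1) (eps_ i.*2.+1 < 0)%R + lambda + (eps_ j.+1.*2.+1 < 0)%R)%N.
  by rewrite big_ltn// -addnA addnC.
move=> gN; pose c := eps_ j.*2.+1 * (alpha j.*2.+1 * alpha j.*2.+2) * eps_ j.*2.+3.
exists (fun z => sscale (- c)
  (sinv (sscale (eps_ j.+1.*2.+1) (cf_denom alpha beta eps psi k j.+1 z)))); split.
- exact: (nevanlinna_sinv (cf_sign_gt0 jm) gg gN).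
- exact: littleo_sinv gg.
- move=> z /=; rewrite sscale_sadd sscale_sscale.
  by rewrite (sscale_sinv_pm _ _ e1) mulrN mulNr doubleS.
Qed.

Lemma cf_kappaE : cf_kappa alpha eps m = (\sum_(0 <= i < m.+1) (eps_ i.*2.+1 < 0)%R)%N.
Proof.
rewrite /cf_kappa -sum1_card big_mkord big_mkcond; apply: eq_bigr => i _.
by rewrite inE; case: ifP.
Qed.

Lemma cfrac_nevanlinna :
  nevanlinna (cf_kappa alpha eps m + lambda)
    (fun z => sscale (eps_ 0%N) (cfrac alpha beta eps psi m z)).
Proof.
have [f [fN fo fE]] := cf_denom_nevanlinna (add0n m).
have e1 := cf_sign_pm 1%N.
have gE : (fun z => sscale (eps_ 1%N) (cf_denom alpha beta eps psi m 0 z)) =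
    (fun z => sadd (affine (eps_ 1%N) (beta 0%N) z) (f z)).
  exact/funext.
have gg := affine_grows (beta 0%N) e1 fo.
have := nevanlinna_affine (beta 0%N) e1 fN fo; rewrite -gE in gg *.
have <- : (cf_kappa alpha eps m + lambda =
    \sum_(1 <= i < m.+1) (eps_ i.*2.+1 < 0)%R + lambda + (eps_ 1%N < 0)%R)%N.
  by rewrite cf_kappaE big_ltn// -addnA addnC.
move=> gN.
have -> : (fun z => sscale (eps_ 0%N) (cfrac alpha beta eps psi m z)) =
    (fun z => sscale (- (eps_ 0%N * alpha 0%N * eps_ 1%N))
      (sinv (sscale (eps_ 1%N) (cf_denom alpha beta eps psi m 0 z)))).
  apply/funext => z.
  by rewrite /cfrac sscale_sscale (sscale_sinv_pm _ _ e1) mulrN mulNr.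
apply: (nevanlinna_sinv _ gg gN).
rewrite cf_sign_step// mulrAC -(mulrA (Num.sg _)) pm_sqr// mulr1 -normrEsg.
by rewrite normr_gt0; exact: alpha_neq0.
Qed.
End Last.

Lemma cf_kappa_formula : (cf_kappa alpha eps m)%:R =
  m.+1%:R / 2 - \sum_(0 <= j < m.+1) eps_ j.*2.+1 / 2.
Proof.
rewrite cf_kappaE natr_sum.
have -> : m.+1%:R / 2 = \sum_(0 <= j < m.+1) (1 / 2 : R).
  by rewrite big_mkord sumr_const card_ord -[RHS]mulr_natl mul1r.
rewrite -sumrB; apply: eq_bigr => i _.
by case: (cf_sign_pm i.*2.+1) => ->; rewrite ?ltrN10 ?ltr10 /=; lra.
Qed.
End Recursion.

(** * Degree of the rational case *)

Section Degree.
Variables (R : realType) (alpha beta : nat -> R) (m : nat).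
Hypothesis alpha_neq0 : forall k : nat, (k <= m.*2)%N -> alpha k != 0.
Local Notation C := R[i].

Definition quotient_value (p q : {poly C}) (z : C) : sphere R :=
  if q.[z] == 0 then None else Some (p.[z] / q.[z]).

(** Coprime polynomials have no common root, so the indeterminate case 0/0 does
    not occur. *)
Lemma sinv_quotient (p q : {poly C}) z : coprimep p q ->
  sinv (quotient_value p q z) = quotient_value q p z.
Proof.
move=> pq; rewrite /quotient_value; have [q0|q0] /= := eqVneq q.[z] 0.
  have := coprimep_root; move=> /(_ _ q p z); rewrite coprimep_sym => /(_ pq).
  by rewrite /root q0 eqxx => /(_ isT) /negPf ->; rewrite mul0r.
rewrite mulf_eq0 invr_eq0 (negPf q0) orbF; case: eqP => // p0.
by rewrite invf_div.
Qed.

Lemma sscale_quotient (a : R) (p q : {poly C}) z :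
  sscale a (quotient_value p q z) = quotient_value (a%:C *: p) q z.
Proof.
by rewrite /quotient_value; case: eqP => //= _; rewrite hornerZ mulrA.
Qed.

Lemma sadd_quotient (r p q : {poly C}) z :
  sadd r.[z] (quotient_value p q z) = quotient_value (r * q + p) q z.
Proof.
rewrite /quotient_value; case: eqP => //= /eqP q0.
by rewrite hornerD hornerM mulrDl mulfK.
Qed.

(** Numerators and denominators obey the recursion
    [p_j = (z - beta_j) p_(j+1) - a p_(j+2)], [q_j = p_(j+1)]; coprimality
    descends because [a] is nonzero. *)
Lemma cf_denom_quotient k j : (j + k = m)%N ->
  exists p q : {poly C}, [/\ coprimep p q, size p = k.+2, size q = k.+1 &
    forall z, cf_denom alpha beta 1 (fun _ => Some 0) k j z = quotient_value p q z].
Proof.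
elim: k j => [|k IH] j jk.
  exists ('X - (beta j)%:C%:P), 1; split; rewrite ?coprimep1 ?size_XsubC ?size_poly1//.
  move=> z; rewrite /quotient_value hornerC oner_eq0 divr1 /= hornerXsubC.
  by rewrite mulr0 addr0.
have jm : (j < m)%N by rewrite -jk addnS ltnS leq_addr.
have [p [q [pq sp sq pqE]]] := IH j.+1 (etrans (addSnnS _ _) jk).
set a : C := (- (alpha j.*2.+1 * alpha j.*2.+2))%:C.
have a0 : a != 0.
  rewrite fmorph_eq0 oppr_eq0 mulf_neq0//; apply: alpha_neq0.
    by rewrite ltn_double.
  by rewrite -doubleS leq_double.
exists (('X - (beta j)%:C%:P) * p + a *: q), p; split => //.
- by rewrite coprimep_sym coprimep_addl_mul coprimepZr.
- have s1 : size (('X - (beta j)%:C%:P) * p) = k.+3.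
    by rewrite size_monicM ?monicXsubC ?size_XsubC ?sp// -size_poly_eq0 sp.
  by rewrite size_polyDl s1// (leq_ltn_trans (size_scale_leq _ _))// sq.
move=> z /=; rewrite pqE sinv_quotient// sscale_quotient -sadd_quotient.
by rewrite hornerXsubC.
Qed.

Lemma cfrac_degree :
  rational_of_degree (cfrac alpha beta 1 (fun _ => Some 0) m) m.+1.
Proof.
have [p [q [pq sp sq pqE]]] := cf_denom_quotient (add0n m).
have a0 : (- alpha 0%N)%:C != 0 by rewrite fmorph_eq0 oppr_eq0 alpha_neq0.
exists ((- alpha 0%N)%:C *: q), p; split.
- by rewrite -size_poly_eq0 sp.
- by rewrite coprimepZl// coprimep_sym.
- by move=> z; rewrite /cfrac pqE sinv_quotient// sscale_quotient.
- by rewrite size_scale// sq sp /=; apply/esym/maxn_idPr.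
Qed.
End Degree.

(** * The zero function and the conclusion *)

Section Zero.
Local Open Scope classical_set_scope.
Local Open Scope ring_scope.
Local Open Scope complex_scope.
Local Open Scope sesquilinear_scope.
Variable R : realType.
Local Notation C := R[i].

Lemma nevanlinna_zero : nevanlinna 0 (fun _ : C => Some 0 : sphere R).
Proof.
have H n (z : 'I_n -> C) : num_neg_eigenvalues (pick_matrix (fun _ => Some 0) z) = 0%N.
  set A := pick_matrix _ _.
  have A0 : A = 0 by apply/matrixP => i j; rewrite !mxE /= rmorph0 subrr mul0r.
  have [W rW neg] := negative_on_num_neg (pick_hermitian (fun _ => Some 0) z).
  have W0 : W = 0.
    apply/eqP/negPn/negP => /rowV0Pn[u uW u0].
    by have := neg u uW u0; rewrite -/A A0 /qform mulmx0 mul0mx mxE ltxx.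
  by apply/eqP; rewrite -leqn0 (leq_trans rW)// W0 mxrank0.
split.
- move=> z zU; left; apply: (@holomorphicI _ _ (fun=> 0)).
  by apply: filterS (near_upper zU) => w _; split; [by []|exact: derivable_cst].
- by move=> z _ /=; rewrite rmorph0.
- by move=> n z _ _; rewrite H.
- exists 1%N, (fun _ => 0 +i* 1); split; [by []| |exact: H].
  by move=> k; split => //=; exact: ltr01.
Qed.

Lemma littleo_zero : littleo_imag_axis (fun _ : C => Some 0 : sphere R).
Proof.
move=> e e0; have := nbhs_pinfty_ge (num_real (0 : R)).
apply: filterS => y y0; exists 0; rewrite // normr0 ler0c mulr_ge0//.
exact: ltW.
Qed.
End Zero.

Lemma cf_denom_zero (R : realType) (alpha beta : nat -> R) (eps eps' : R) k j z :
  cf_denom alpha beta eps (fun _ => Some 0) k j z =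
  cf_denom alpha beta eps' (fun _ => Some 0) k j z.
Proof. by elim: k j => [|k IH] j /=; rewrite ?mulr0 ?IH. Qed.

Theorem lemma3p14 (R : realType) (m : nat) (alpha beta : nat -> R)
    (alpha_neq0 : forall k : nat, (k <= m.*2)%N -> alpha k != 0) :
  (forall (lambda : nat) (eps : R) (psi_last : R[i] -> sphere R),
     eps = 1 \/ eps = -1 ->
     nevanlinna lambda psi_last ->
     littleo_imag_axis psi_last ->
     let psi := cfrac alpha beta eps psi_last m in
     let eps_ := cf_sign alpha eps m in
     let kappa := cf_kappa alpha eps m in
     kappa%:R = m.+1%:R / 2 - \sum_(0 <= j < m.+1) eps_ j.*2.+1 / 2 /\
     nevanlinna (kappa + lambda) (fun z => sscale (eps_ 0%N) (psi z))) /\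
  (let psi := cfrac alpha beta 1 (fun _ => Some 0) m in
   let eps_ := cf_sign alpha 1 m in
   let kappa := cf_kappa alpha 1 m in
   [/\ kappa%:R = m%:R / 2 - \sum_(1 <= j < m.+1) eps_ j.*2.-1 / 2,
       nevanlinna kappa (fun z => sscale (eps_ 0%N) (psi z)),
       nevanlinna (m.+1 - kappa) (fun z => sscale (- eps_ 0%N) (psi z))
     & rational_of_degree psi m.+1]).
Proof.
have one : (1 : R) = 1 \/ (1 : R) = -1 by left.
have mone : (-1 : R) = 1 \/ (-1 : R) = -1 by right.
have N0 := @nevanlinna_zero R; have o0 := @littleo_zero R.
split=> [lambda eps psi heps psiN psio|].
  split; first exact: cf_kappa_formula.
  exact: cfrac_nevanlinna.
move=> psi eps_ kappa; split.
- have := cf_kappa_formula alpha_neq0 one; rewrite -/kappa => ->.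
  rewrite big_nat_recr//= cf_sign_last [in RHS]big_add1 /=.
  rewrite -natr1 mulrDl opprD addrACA subrr addr0.
  by congr (_ - _); apply: eq_bigr => i _.
- by have := cfrac_nevanlinna beta alpha_neq0 one N0 o0; rewrite addn0.
(* Since the last function vanishes, its sign may be taken to be -1 without
   changing [psi]; all the [eps_j] then change sign. *)
- have := cfrac_nevanlinna beta alpha_neq0 mone N0 o0; rewrite addn0.
  have sN j : cf_sign alpha (-1) m j = - eps_ j by rewrite /eps_ /cf_sign mulN1r mul1r.
  have psiE : cfrac alpha beta (-1) (fun _ => Some 0) m = psi.
    by apply/funext => z; rewrite /psi /cfrac (cf_denom_zero _ _ _ 1).
  suff -> : cf_kappa alpha (-1) m = (m.+1 - kappa)%N by rewrite sN psiE.
  rewrite /kappa /cf_kappa; pose A := [set j : 'I_m.+1 | cf_sign alpha 1 m j.*2.+1 < 0]%SET.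
  rewrite -/A.
  have -> : (m.+1 - #|A| = #|(~: A)%SET|)%N.
    by rewrite -[RHS](addKn #|A|) cardsC card_ord.
  apply: eq_card => j; rewrite !inE sN oppr_lt0 /eps_.
  by case: (cf_sign_pm alpha_neq0 one j.*2.+1) => ->; rewrite ?ltr01 ?ltr10 ?ltrN10 ?ltr0N1.
- exact: cfrac_degree.
Qed.
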